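(* Let $f:\mathbb{R}^n\to\bar{\mathbb{R}}$ and $g:\mathbb{R}^m\to\bar{\mathbb{R}}$ be lower semicontinuous proper convex functions, let $A\in\mathbb{R}^{m\times n}$ be a matrix, and let $T_a:=T_a(A\operatorname{dom}(f),\operatorname{dom}(g))$ be the affine joint supporting subspace. A point $x\in\mathbb{R}^n$ is a minimizer of the convex program $\operatorname{minimize}_{x\in\mathbb{R}^n} f(x)+g(Ax)$ if, and only if, there exists some $y\in\mathbb{R}^m$ such that 1. $Ax\in\partial\big((g+\iota_{T_a})^*\big)(-y)$, and 2. $A^Ty\in\partial(f+\iota_{A^{-1}(T_a)})(x)$.
   Context: A minimizer of a convex program is a point that attains the infimum of the program, provided that the infimum is finite (if the infimum is not finite there are no minimizers). $\bar{\mathbb{R}}=\mathbb{R}\cup\{-\infty,\infty\}$. For convex $f$, $\operatorname{dom}(f)=\{x: f(x)\neq\infty\}$; $f$ is proper if it is nowhere $-\infty$ and $\operatorname{dom}(f)\ne\emptyset$. The subdifferential is $\partial f(x)=\{v \mid \forall y,\ f(x)+\langle v,y-x\rangle\le f(y)\}$ for $x\in\operatorname{dom}(f)$, and $\partial f(x)=\emptyset$ when $x\notin\operatorname{dom}(f)$. The convex conjugate is $f^*(y)=\sup_x\langle y,x\rangle-f(x)$. For a set $S$, $\iota_S$ is the indicator function, $0$ on $S$ and $\infty$ off $S$. A matrix $A$ is identified with its linear map; $AS$ is the image of $S$ and $A^{-1}(S)$ the preimage of $S$ (no invertibility assumed). $B\pm B'=\{b\pm b'\mid b\in B,b'\in B'\}$.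 Faces: for $C\subseteq\mathbb{R}^m$ convex, a subset $F\subseteq C$ is a face of $C$ if for all $y,z\in C$, whenever the open segment $]y,z[ = [y,z]\setminus\{y,z\}$ meets $F$, both $y,z\in F$. For $S\subseteq C$, $F_C(S)$ denotes the smallest face of $C$ containing $S$; $F_C(x)=F_C(\{x\})$. Joint supporting subspace: for convex $C,D\subseteq\mathbb{R}^m$ with $C\cap D\neq\emptyset$, $T(C,D):=\operatorname{Span} F_{C-D}(0)$ (linear span) and $T_a(C,D):=T(C,D)+(C\cap D)$. If $C\cap D=\emptyset$, then $T_a(C,D)=\emptyset$. *)

(* Defs.v *)
(* MathComp-Analysis *)
From HB Require Import structures.
From mathcomp Require Import all_boot all_order all_algebra.
From mathcomp Require Import all_classical all_reals all_analysis.

Set Implicit Arguments.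
Unset Strict Implicit.
Unset Printing Implicit Defensive.

Import Order.TTheory GRing.Theory Num.Theory.
Import numFieldNormedType.Exports.

Local Open Scope classical_set_scope.
Local Open Scope ring_scope.

Section convex_sets.
Context {R : realType} {V : lmodType R}.
Implicit Types C D F S : set V.

(* [y, z] with its endpoints removed, so it is empty when y = z *)
Definition open_segment (y z : V) : set V :=
  [set (1 - t) *: y + t *: z | t in `[0, 1]%classic] `\` [set y; z].

Definition is_face C F :=
  F `<=` C /\
  forall y z, C y -> C z -> open_segment y z `&` F !=set0 -> F y /\ F z.

(* Faces of C containing S are stable under intersection when S `<=` C, so this
   intersection of all of them is the least one. If S is not included in C it is
   the full space. *)
Definition face_hull C S : set V := smallest (is_face C) S.

Definition linear_span S : set V :=
  smallest (fun W : set V => submod_closed [in W]) S.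

(* meaningful only when C and D meet, i.e., when 0 belongs to C - D *)
Definition joint_support C D : set V :=
  linear_span (face_hull [set c - d | c in C & d in D] [set 0]).

(* empty when C and D are disjoint *)
Definition affine_joint_support C D : set V :=
  [set t + x | t in joint_support C D & x in C `&` D].

End convex_sets.

Section extended_functions.
Context {R : realType}.
Local Open Scope ereal_scope.

Definition dom {V : Type} (f : V -> \bar R) : set V := [set x | f x != +oo].

Definition proper_efun {V : Type} (f : V -> \bar R) :=
  (forall x, f x != -oo) /\ dom f !=set0.

(* Convexity of the epigraph, which also makes sense when f takes both
   values -oo and +oo. *)
Definition convex_efun {V : lmodType R} (f : V -> \bar R) :=
  convex_set [set p : V * R^o | f p.1 <= (p.2)%:E].

Definition indicator {V : Type} (S : set V) (x : V) : \bar R :=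
  if x \in S then 0 else +oo.

Definition is_minimizer {V : Type} (h : V -> \bar R) (x : V) :=
  ereal_inf (range h) \is a fin_num /\ h x = ereal_inf (range h).

Definition dotp {n : nat} (u v : 'cV[R]_n) : R := (\sum_i u i 0 * v i 0)%R.

Definition subdiff {n : nat} (f : 'cV[R]_n -> \bar R) (x : 'cV[R]_n) :
    set 'cV[R]_n :=
  [set v | x \in dom f /\ forall y, f x + (dotp v (y - x))%:E <= f y].

Definition conjugate {n : nat} (f : 'cV[R]_n -> \bar R) (y : 'cV[R]_n) :
    \bar R :=
  ereal_sup (range (fun x => (dotp y x)%:E - f x)).

End extended_functions.

(* Main.v *)
Require Import Defs.
From HB Require Import structures.
From mathcomp Require Import all_boot all_order all_algebra.
From mathcomp Require Import all_classical all_reals all_analysis.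
From mathcomp Require Import ring lra.
Set Implicit Arguments.
Unset Strict Implicit.
Unset Printing Implicit Defensive.

Import Order.TTheory GRing.Theory Num.Theory.
Import numFieldNormedType.Exports.
Local Open Scope classical_set_scope.
Local Open Scope ring_scope.

(** Write [C = A (dom f)], [D = dom g], [f' = f + iota_(A^-1 Ta)] and
    [g' = g + iota_Ta].

    The restriction to [Ta] costs nothing and buys a constraint qualification.
    It costs nothing because [C `&` D] lies in [Ta]: the sums [f + g A] and
    [f' + g' A] agree wherever the first one is finite. It buys a qualification
    because the face of [C - D] at [0] consists of the [w] in [C - D] such that
    some negative multiple of [w] is again in [C - D] (face_hull0E), so that [0]
    is in the relative interior of [dom f' - dom g'], read algebraically: with
    [c - d], this difference contains some [- e (c - d)], [e > 0]
    (affine_joint_support_opposite).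

    Under this qualification the subdifferential sum rule holds
    (subgradient_sum_rule): at a minimizer [x] of [f' + g' A] some [y] satisfies
    [- y \in subdiff g' (A x)] and [A^T y \in subdiff f' x]. It comes from
    separating the origin of [R^m * R] from the set of all
    [(A z - w, t)] with [t > f' z + g' w - min]. The qualification excludes a
    vertical separating hyperplane, since a nonnegative functional of [A z - w]
    taking a positive value also takes a negative one. Conversely two such
    subgradient inequalities add up to the minimality of [x].

    It remains to exchange [- y \in subdiff g' (A x)] with
    [A x \in subdiff (conjugate g') (- y)]. One direction is a computation
    (conjugate_subgradient); the other needs that affine minorants of [g'] reach
    any value below [g' (A x)] (affine_minorant), which is again a separation,
    of a small ball at a height below [g] from the epigraph of [g'] (a convex
    set). The ball exists because [A x] is in [Ta] as soon as [x] is in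
    [dom f'], so that [g] and [g'] agree at [A x], and [g] is lower
    semicontinuous.

    All separations rest on one algebraic statement (proper_separation): a
    nonempty convex subset of [R^n] without the origin lies in a closed half
    space through the origin, and not entirely in its boundary. It is proved by
    induction on [n]. *)

(** * Convex sets and the dot product *)

Lemma convex_set_comb (R : realType) (V : lmodType R) (K : set V)
    (x y : V) (s t : R) :
  convex_set K -> K x -> K y -> 0 <= s -> 0 <= t -> s + t = 1 ->
  K (s *: x + t *: y).
Proof.
move=> cK Kx Ky s0 t0 st.
have s01 : (0 <= s <= 1)%R by rewrite s0 -st lerDl.
have := cK x y (Itv01 (proj1 (andP s01)) (proj2 (andP s01))).
rewrite !inE => /(_ Kx Ky).
rewrite /conv /=.
suff -> : unstable.onem s = t by [].
by rewrite /unstable.onem -st addrC addKr.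
Qed.

Lemma convex_set_from_comb (R : realType) (V : lmodType R) (K : set V) :
  (forall (x y : V) (s t : R), K x -> K y -> 0 < s -> 0 < t -> s + t = 1 ->
    K (s *: x + t *: y)) -> convex_set K.
Proof.
move=> cK; apply/convex_setW => x y; rewrite !inE => Kx Ky l l0 l1; rewrite inE.
have := cK x y l%:num (unstable.onem l%:num) Kx Ky l0; apply.
  by rewrite /unstable.onem subr_gt0.
by rewrite /unstable.onem addrC subrK.
Qed.

Section dotp_theory.
Context {R : realType} {n : nat}.
Implicit Types (u v w : 'cV[R]_n) (a : R).

Lemma dotpE u v : dotp u v = (u^T *m v) 0 0.
Proof. by rewrite mxE; apply: eq_bigr => i _; rewrite mxE. Qed.

Lemma dotpC u v : dotp u v = dotp v u.
Proof. by apply: eq_bigr => i _; rewrite mulrC. Qed.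

Lemma dotpDr u v w : dotp u (v + w) = dotp u v + dotp u w.
Proof. by rewrite !dotpE mulmxDr mxE. Qed.

Lemma dotpZr u a v : dotp u (a *: v) = a * dotp u v.
Proof. by rewrite !dotpE -scalemxAr mxE. Qed.

Lemma dotpNr u v : dotp u (- v) = - dotp u v.
Proof. by rewrite -scaleN1r dotpZr mulN1r. Qed.

Lemma dotpBr u v w : dotp u (v - w) = dotp u v - dotp u w.
Proof. by rewrite dotpDr dotpNr. Qed.

Lemma dotp0r u : dotp u 0 = 0.
Proof. by rewrite dotpE mulmx0 mxE. Qed.

Lemma dotpDl u v w : dotp (u + v) w = dotp u w + dotp v w.
Proof. by rewrite !(dotpC _ w) dotpDr. Qed.

Lemma dotpZl a u v : dotp (a *: u) v = a * dotp u v.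
Proof. by rewrite !(dotpC _ v) dotpZr. Qed.

Lemma dotpNl u v : dotp (- u) v = - dotp u v.
Proof. by rewrite !(dotpC _ v) dotpNr. Qed.

Lemma dotp_self_gt0 u : u != 0 -> 0 < dotp u u.
Proof.
move=> u0; rewrite lt_neqAle eq_sym sumr_ge0 ?andbT => [|i _]; last exact: sqr_ge0.
apply: contra_neq u0 => /eqP; rewrite psumr_eq0 => [|i _]; last exact: sqr_ge0.
move=> /allP uu0; apply/colP => i; rewrite mxE.
have := uu0 i (mem_index_enum i).
by rewrite mulf_eq0 orbb => /eqP.
Qed.

End dotp_theory.

Lemma dotp_trmx (R : realType) (m n : nat) (A : 'M[R]_(m, n)) y z :
  dotp (A^T *m y) z = dotp y (A *m z).
Proof. by rewrite !dotpE trmx_mul trmxK mulmxA. Qed.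

Lemma dotp_col_mx (R : realType) (m n : nat) (u u' : 'cV[R]_m) (v v' : 'cV[R]_n) :
  dotp (col_mx u v) (col_mx u' v') = dotp u u' + dotp v v'.
Proof. by rewrite !dotpE tr_col_mx mul_row_col mxE. Qed.

(** * Proper separation in finite dimension *)

Lemma real_between (R : realType) (L U : set R) :
  (forall x y, L x -> U y -> x <= y) ->
  L !=set0 -> U !=set0 ->
  exists s, (forall x, L x -> x <= s) /\ (forall y, U y -> s <= y).
Proof.
move=> LU L0 [y0 Uy0]; exists (sup L); split=> [x Lx|y Uy].
  by apply: ub_le_sup => //; exists y0 => z Lz; apply: LU.
by apply: ge_sup => // z Lz; apply: LU.
Qed.

(** The second clause makes the separation proper: the functional is not merely
    zero on [K]. *)
Definition properly_separates {R : realType} {n : nat} (v : 'cV[R]_n) (s : R)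
    (K : set ('cV[R]_n * R^o)) :=
  (forall p, K p -> 0 <= dotp v p.1 + s * p.2) /\
  (exists2 p, K p & 0 < dotp v p.1 + s * p.2).

(** The induction step. If [K] misses the hyperplane [t = 0], it lies strictly
    on one side of it. Otherwise the slice [t = 0] is separated from the origin
    by some [v]; extending [v] with a slope [s] amounts to finding [s] above all
    [- <v, u> / t] with [t > 0] and below all those with [t < 0], and these two
    families are ordered because a segment joining points on both sides crosses
    the slice. If the points of [K] off the slice are all on one side, the
    coordinate [t] itself, up to sign, separates. *)
Lemma proper_separation_slice (R : realType) (n : nat) :
  (forall K : set 'cV[R]_n, convex_set K -> K !=set0 -> ~ K 0 ->
    exists v, (forall x, K x -> 0 <= dotp v x) /\
      (exists2 x, K x & 0 < dotp v x)) ->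
  forall K : set ('cV[R]_n * R^o), convex_set K -> K !=set0 -> ~ K 0 ->
    exists v s, properly_separates v s K.
Proof.
move=> IH K cK [p0 Kp0] K0.
have above : (exists2 p, K p & 0 < p.2) -> (forall p, K p -> 0 <= p.2) ->
    exists v s, properly_separates v s K.
  move=> [p Kp p_gt0] K_ge0; exists 0, 1; rewrite /properly_separates.
  have E q : dotp (0 : 'cV[R]_n) q.1 + 1 * q.2 = q.2.
    by rewrite dotpC dotp0r add0r mul1r.
  by split=> [q /K_ge0|]; [rewrite E|exists p; rewrite ?E].
have below : (exists2 p, K p & p.2 < 0) -> (forall p, K p -> p.2 <= 0) ->
    exists v s, properly_separates v s K.
  move=> [p Kp p_gt0] K_ge0; exists 0, (-1); rewrite /properly_separates.
  have E q : dotp (0 : 'cV[R]_n) q.1 + (-1) * q.2 = - q.2.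
    by rewrite dotpC dotp0r add0r mulN1r.
  split=> [q /K_ge0|]; first by rewrite E oppr_ge0.
  by exists p; rewrite // E oppr_gt0.
(* the weights are those for which the last coordinates cancel *)
have crossing p q : K p -> K q -> 0 < p.2 -> q.2 < 0 ->
    K ((- q.2 / (p.2 - q.2)) *: p.1 + (p.2 / (p.2 - q.2)) *: q.1, 0).
  move=> Kp Kq p_gt0 q_lt0; have d_gt0 : 0 < p.2 - q.2 by lra.
  have -> : ((- q.2 / (p.2 - q.2)) *: p.1 + (p.2 / (p.2 - q.2)) *: q.1, 0) =
      (- q.2 / (p.2 - q.2)) *: p + (p.2 / (p.2 - q.2)) *: q.
    congr pair; rewrite /= /GRing.scale /=; field; lra.
  apply: convex_set_comb => //.
  - by rewrite divr_ge0 ?oppr_ge0 // ltW.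
  - by rewrite divr_ge0 // ltW.
  - field; lra.
have [[u0 Ku0]|no_slice] := pselect (exists u, K (u, 0)); last first.
  have nz p : K p -> p.2 != 0.
    case: p => u t /= Kp; apply/eqP => t0; apply: no_slice.
    by exists u; rewrite -t0.
  have one_sided p q : K p -> K q -> 0 < p.2 -> q.2 < 0 -> False.
    by move=> Kp Kq pp qn; apply: no_slice; eexists; exact: (crossing p q).
  have [p0_gt0|p0_lt0|/eqP] := ltgtP 0 p0.2; last first.
  - by rewrite eq_sym (negbTE (nz _ Kp0)).
  - apply: below; first by exists p0.
    move=> p Kp; rewrite leNgt; apply/negP => pp.
    exact: (one_sided _ _ Kp Kp0 pp p0_lt0).
  - apply: above; first by exists p0.
    by move=> p Kp; rewrite leNgt; apply/negP => /(one_sided _ _ Kp0 Kp p0_gt0).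
have [||//|v [v_ge0 [k0 Kk0 v_gt0]]] := IH [set u | K (u, 0)].
- apply: convex_set_from_comb => x y s t Kx Ky s0 t0 st /=.
  have -> : (s *: x + t *: y, 0) =
      s *: ((x, 0) : 'cV[R]_n * R^o) + t *: ((y, 0) : 'cV[R]_n * R^o).
    by congr pair; rewrite /= !scaler0 addr0.
  by apply: convex_set_comb; rewrite ?ltW.
- by exists u0.
have [Kle|] := pselect (forall p, K p -> p.2 <= 0).
  have [[p Kp pl]|nl] := pselect (exists2 p, K p & p.2 < 0).
    by apply: below => //; exists p.
  exists v, 0; split=> [[u t] Kp|]; last first.
    by exists (k0, 0); rewrite //= mulr0 addr0.
  rewrite /= mul0r addr0; apply: v_ge0 => /=.
  have /= := Kle _ Kp; rewrite le_eqVlt => /orP[/eqP t0|t_lt0].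
    by rewrite -t0.
  by exfalso; apply: nl; exists (u, t).
move=> /existsNP[pp /not_implyP[Kpp /negP]]; rewrite -ltNge => pp_gt0.
have [Kge|] := pselect (forall p, K p -> 0 <= p.2).
  by apply: above => //; exists pp.
move=> /existsNP[pn /not_implyP[Kpn /negP]]; rewrite -ltNge => pn_lt0.
have [|||s [sL sU]] := @real_between R
    [set - dotp v p.1 / p.2 | p in K `&` [set p | 0 < p.2]]
    [set - dotp v p.1 / p.2 | p in K `&` [set p | p.2 < 0]].
- move=> _ _ [p [Kp /= p_gt0] <-] [q [Kq /= q_lt0] <-].
  have d_gt0 : 0 < p.2 - q.2 by lra.
  have := v_ge0 _ (crossing p q Kp Kq p_gt0 q_lt0); rewrite dotpDr !dotpZr => h.
  have {}h : 0 <= - q.2 * dotp v p.1 + p.2 * dotp v q.1.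
    by move: h; rewrite mulrAC (mulrAC p.2) -mulrDl pmulr_lge0 ?invr_gt0.
  rewrite ler_pdivrMr // mulrAC ler_ndivlMr //; nra.
- by exists (- dotp v pp.1 / pp.2), pp.
- by exists (- dotp v pn.1 / pn.2), pn.
exists v, s; split=> [[u t] Kp /=|]; last first.
  by exists (k0, 0); rewrite //= mulr0 addr0.
have [t_gt0|t_lt0|t0] := ltgtP 0 t.
- have := sL _ (ex_intro2 _ _ (u, t) (conj Kp t_gt0) erefl).
  by rewrite /= ler_pdivrMr //; lra.
- have := sU _ (ex_intro2 _ _ (u, t) (conj Kp t_lt0) erefl).
  by rewrite /= ler_ndivlMr //; lra.
- by rewrite -t0 mulr0 addr0; apply: v_ge0; rewrite /= t0.
Qed.

Lemma proper_separation (R : realType) (n : nat) (K : set 'cV[R]_n) :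
  convex_set K -> K !=set0 -> ~ K 0 ->
  exists v, (forall x, K x -> 0 <= dotp v x) /\
    (exists2 x, K x & 0 < dotp v x).
Proof.
elim: n K => [K cK [x Kx] []|n IH K cK [x Kx] K0]; first by rewrite -(flatmx0 x).
pose j (p : 'cV[R]_n * R^o) : 'cV[R]_(1 + n) := col_mx (p.2%:M) p.1.
have jP (z : 'cV[R]_(1 + n)) : exists p, z = j p.
  exists (dsubmx z, usubmx z 0 0).
  by rewrite /j /= -mx11_scalar vsubmxK.
have jD (s t : R) p q : j (s *: p + t *: q) = s *: j p + t *: j q.
  rewrite /j !scale_col_mx add_col_mx; congr col_mx.
  by apply/matrixP => i k; rewrite !ord1 !mxE !mulr1n.
have [||//|v [s [vs_ge0 [p Kp vs_gt0]]]] :=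
    proper_separation_slice IH (K := [set p | K (j p)]).
- apply: convex_set_from_comb => p q s t Kp Kq s0 t0 st /=.
  by rewrite jD; apply: convex_set_comb; rewrite ?ltW.
- by have [p xE] := jP x; exists p; rewrite /= -xE.
- rewrite /= /j /=; suff -> : col_mx (0%:M : 'cV[R]_1) (0 : 'cV[R]_n) = 0 by [].
  by rewrite raddf0 col_mx0.
have dE q : dotp (j (v, s)) (j q) = dotp v q.1 + s * q.2.
  by rewrite dotp_col_mx addrC /dotp big_ord1 !mxE.
exists (j (v, s)); split=> [z Kz|]; last by exists (j p); rewrite // dE.
by have [q zE] := jP z; rewrite zE dE; apply: vs_ge0; rewrite /= -zE.
Qed.

Lemma proper_separation_pair (R : realType) (n : nat) (K : set ('cV[R]_n * R^o)) :
  convex_set K -> K !=set0 -> ~ K 0 -> exists v s, properly_separates v s K.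
Proof. exact/proper_separation_slice/proper_separation. Qed.

(** * Faces at the origin and the joint supporting subspace *)

Section joint_support_theory.
Context {R : realType} {V : lmodType R}.
Implicit Types B C D S : set V.

Lemma linear_span_sub S : S `<=` linear_span S.
Proof. exact: sub_gen_smallest. Qed.

Lemma linear_span0 S : linear_span S 0.
Proof. by move=> W [[W0 _] _]; move: W0; rewrite inE. Qed.

Lemma linear_span_lin S a u v :
  linear_span S u -> linear_span S v -> linear_span S (a *: u + v).
Proof.
move=> Su Sv W [[W0 Wlin] SW].
have WS : submod_closed [in W] /\ S `<=` W by split.
by have := Wlin a u v; rewrite !inE; apply; [exact: Su|exact: Sv].
Qed.

(** The set on the right is a face: if [u], strictly between [y] and [z] in [B],
    can be prolonged backwards past the origin, then averaging that prolongation
    with a multiple of [z] removes [z] and leaves a negative multiple of [y]. It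
    is the least one, because [0] is strictly between [w] and [- e *: w] for
    nonzero [w]. *)
Lemma face_hull0E B : convex_set B -> B 0 ->
  face_hull B [set 0] = [set w | B w /\ exists2 e : R, 0 < e & B (- e *: w)].
Proof.
move=> cB B0; apply/seteqP; split=> [|w [Bw [e e_gt0 Bew]] F [[FB faceF] F0]].
  apply: smallest_sub; last first.
    by move=> z ->; split=> //; exists 1; rewrite ?scaler0.
  split=> [v []//|y z By Bz [w [[[t]]]]].
  rewrite /= in_itv /= => /andP[t0 t1] <- /not_orP[ny nz] [Bu [e e_gt0 Beu]].
  have {}t0 : 0 < t.
    rewrite lt_neqAle t0 andbT; apply/eqP => t00; apply: ny.
    by rewrite -t00 subr0 scale1r scale0r addr0.
  have {}t1 : t < 1.
    rewrite lt_neqAle t1 andbT; apply/eqP => t11; apply: nz.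
    by rewrite t11 subrr scale1r scale0r add0r.
  suff opp (y' z' : V) (s s' : R) : 0 < s -> 0 < s' -> B y' -> B z' ->
      B (- e *: (s *: y' + s' *: z')) -> exists2 d : R, 0 < d & B (- d *: y').
    split; split=> //.
      by apply: (opp y z (1 - t) t) => //; rewrite subr_gt0.
    by apply: (opp z y t (1 - t)) => //; [rewrite subr_gt0|rewrite addrC].
  move=> s_gt0 s'_gt0 By' Bz' Bc.
  have q_gt0 : 0 < 1 + e * s' by rewrite addr_gt0 ?mulr_gt0.
  exists (e * s / (1 + e * s')); first by rewrite divr_gt0 ?mulr_gt0.
  have -> : - (e * s / (1 + e * s')) *: y' =
      (1 + e * s')^-1 *: (- e *: (s *: y' + s' *: z')) +
      (e * s' / (1 + e * s')) *: z'.
    rewrite !scalerDr !scalerA -addrA -scalerDl.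
    rewrite [X in _ = _ + X *: z'](_ : _ = 0); last by ring.
    by rewrite scale0r addr0; congr (_ *: _); ring.
  apply: convex_set_comb => //.
  - by rewrite invr_ge0 ltW.
  - by rewrite divr_ge0 ?(ltW q_gt0) // mulr_ge0 ?ltW.
  - by field; rewrite gt_eqF.
have [->|w0] := eqVneq w 0; first by rewrite -[_ 0]/(F 0); exact: F0.
have e1 : 0 < 1 + e by rewrite addr_gt0.
have [] // := faceF w (- e *: w) Bw Bew.
exists 0; split; last exact: F0.
split.
  exists (1 + e)^-1 => /=.
    by rewrite in_itv /= invr_ge0 (ltW e1) /= invf_le1 // lerDl ltW.
  rewrite scalerA -scalerDl.
  have -> : 1 - (1 + e)^-1 + (1 + e)^-1 * - e = 0 by field; rewrite gt_eqF.
  by rewrite scale0r.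
move=> /= [/esym/eqP|/esym/eqP]; first by rewrite (negbTE w0).
by rewrite scaler_eq0 oppr_eq0 (gt_eqF e_gt0) (negbTE w0).
Qed.

(** The [u] of which a small multiple and its opposite are both in [B] form a
    subspace, and it contains the face. *)
Lemma linear_span_face_hull0 B u : convex_set B -> B 0 ->
  linear_span (face_hull B [set 0]) u ->
  exists2 e : R, 0 < e & B (e *: u) /\ B (- e *: u).
Proof.
move=> cB B0; rewrite face_hull0E // => Su.
have shrink w (t : R) : B w -> 0 <= t -> t <= 1 -> B (t *: w).
  move=> Bw t0 t1; rewrite -[t *: w]addr0 -(scaler0 _ (1 - t)).
  by apply: convex_set_comb; rewrite ?subr_ge0 // addrC subrK.
have segment w (e s : R) :
    B (e *: w) -> B (- e *: w) -> 0 < e -> `|s| <= e -> B (s *: w).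
  move=> Bew Bnew e_gt0; rewrite ler_norml => /andP[se1 se2].
  have -> : s *: w =
      ((e + s) / (2 * e)) *: (e *: w) + ((e - s) / (2 * e)) *: (- e *: w).
    by rewrite !scalerA -scalerDl; congr (_ *: _); field; rewrite gt_eqF.
  apply: convex_set_comb => //.
  - by apply: divr_ge0; lra.
  - by apply: divr_ge0; lra.
  - by field; rewrite gt_eqF.
apply: (Su [set u | exists2 e : R, 0 < e & B (e *: u) /\ B (- e *: u)]); split.
  split=> [|a v w]; rewrite !inE /=; first by exists 1; rewrite // !scaler0.
  move=> [d d_gt0 [Bd Bnd]] [e e_gt0 [Be Bne]].
  have a1 : 0 < 1 + `|a| by rewrite ltr_pwDl.
  (* c *: (a *: v + w) is the midpoint of (2 c a) *: v and (2 c) *: w *)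
  pose c := Num.min (d / (1 + `|a|)) e / 2.
  have c_gt0 : 0 < c by rewrite divr_gt0 // lt_min divr_gt0.
  have c2 : 2 * c = Num.min (d / (1 + `|a|)) e by rewrite /c mulrC divfK.
  have c2_gt0 : 0 < 2 * c by rewrite mulr_gt0.
  have ca : `|2 * c * a| <= d.
    rewrite normrM (gtr0_norm c2_gt0) -[X in _ <= X](divfK (lt0r_neq0 a1)).
    by apply: ler_pM; rewrite // ?c2 ?ge_min ?lexx ?lerDr // -c2 ltW.
  have ce : `|2 * c| <= e by rewrite (gtr0_norm c2_gt0) c2 ge_min lexx orbT.
  have half_comb (x : R) : `|x| = 1 -> B ((x * c) *: (a *: v + w)).
    move=> x1.
    have -> : (x * c) *: (a *: v + w) =
        2^-1 *: ((x * (2 * c * a)) *: v) + 2^-1 *: ((x * (2 * c)) *: w).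
      by rewrite scalerDr !scalerA; congr (_ *: _ + _ *: _); field.
    apply: convex_set_comb; [by []|..|lra|lra|lra].
    - by apply: (segment _ d) => //; rewrite normrM x1 mul1r.
    - by apply: (segment _ e) => //; rewrite normrM x1 mul1r.
  exists c => //; split.
    by rewrite -[c]mul1r; apply: half_comb; rewrite normr1.
  by rewrite -mulN1r; apply: half_comb; rewrite normrN normr1.
move=> w [Bw [e e_gt0 Bew]] /=.
have e1 : 0 < 1 + e by rewrite addr_gt0.
exists (e / (1 + e)); first by rewrite divr_gt0.
split.
  apply: shrink => //; first by rewrite divr_ge0 ?ltW.
  by rewrite ler_pdivrMr // mul1r lerDr.
rewrite -mulNr mulrC -scalerA; apply: shrink => //.
  by rewrite invr_ge0 ltW.
by rewrite invf_le1 // lerDl ltW.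
Qed.

Lemma convex_set_sub C D : convex_set C -> convex_set D ->
  convex_set [set c - d | c in C & d in D].
Proof.
move=> cC cD; apply: convex_set_from_comb.
move=> _ _ s t [c Cc [d Dd <-]] [c' Cc' [d' Dd' <-]] s0 t0 st.
exists (s *: c + t *: c'); first by apply: convex_set_comb => //; exact: ltW.
exists (s *: d + t *: d'); first by apply: convex_set_comb => //; exact: ltW.
by rewrite !scalerBr opprD addrACA.
Qed.

Lemma affine_joint_support_meet C D p : C p -> D p -> affine_joint_support C D p.
Proof.
by move=> Cp Dp; exists 0; [exact: linear_span0|exists p; rewrite ?add0r].
Qed.

Lemma convex_affine_joint_support C D : convex_set C -> convex_set D ->
  convex_set (affine_joint_support C D).
Proof.
move=> cC cD; apply: convex_set_from_comb.
move=> _ _ s t [u Tu [p [Cp Dp] <-]] [v Tv [q [Cq Dq] <-]] s0 t0 st.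
exists (s *: u + t *: v).
  apply: linear_span_lin => //; rewrite -[t *: v]addr0.
  apply: linear_span_lin => //.
  exact: linear_span0.
exists (s *: p + t *: q); first by split; apply: convex_set_comb => //; exact: ltW.
by rewrite !scalerDr addrACA.
Qed.

(** The constraint qualification. As [c - d] is in the supporting subspace, some
    [- e *: (c - d)] equals [c' - d'] with [c'] in [C] and [d'] in [D]. The
    weighted means of [c'], [c] and of [d'], [d] then coincide in a common point
    [m] of [C] and [D]. Seen from [m], the points [c] and [c'] are in opposite
    directions within [C - D], hence in the face at the origin, so [c'] is in the
    affine subspace; likewise for [d']. *)
Lemma affine_joint_support_opposite C D c d : convex_set C -> convex_set D ->
  C c -> D d -> affine_joint_support C D c -> affine_joint_support C D d ->
  exists c' d', [/\ C c', D d', affine_joint_support C D c',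
    affine_joint_support C D d' & exists2 e : R, 0 < e & c' - d' = - e *: (c - d)].
Proof.
move=> cC cD Cc Dd [u Tu [p [Cp Dp] cE]] [v Tv [q [Cq Dq] dE]].
pose B := [set c - d | c in C & d in D].
have Bsub x y : C x -> D y -> B (x - y) by move=> Cx Dy; exists x => //; exists y.
have cB : convex_set B by exact: convex_set_sub.
have B0 : B 0 by rewrite -(subrr p); apply: Bsub.
have opposite w (e : R) : 0 < e -> B w -> B (- e *: w) -> joint_support C D w.
  move=> e_gt0 Bw Bew; apply: linear_span_sub.
  by rewrite -/B face_hull0E //; split=> //; exists e.
have T_comb a x y : joint_support C D x -> joint_support C D y ->
    joint_support C D (a *: x + y) by exact: linear_span_lin.
have T0 : joint_support C D 0 by exact: linear_span0.
have Tcd : joint_support C D (c - d).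
  have Tpq : joint_support C D (p - q).
    apply: (opposite _ 1) => //; first exact: Bsub.
    by rewrite scaleN1r opprB; apply: Bsub.
  rewrite -cE -dE opprD addrACA -[u - v]addrC -scaleN1r -addrA.
  by apply: (T_comb) => //; rewrite -[u]scale1r; apply: T_comb.
have [e e_gt0 [_ [c' Cc' [d' Dd' cdE]]]] := linear_span_face_hull0 cB B0 Tcd.
have e1 : 0 < 1 + e by rewrite addr_gt0.
pose m := (1 + e)^-1 *: c' + (e / (1 + e)) *: c.
have mE : m = (1 + e)^-1 *: d' + (e / (1 + e)) *: d.
  have c'E : c' = d' + - e *: (c - d) by rewrite -cdE addrC subrK.
  rewrite /m {1}c'E scalerDr -addrA; congr (_ + _).
  by rewrite scalerA mulrN (mulrC _ e) scaleNr scalerBr opprB subrK.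
have [w0 w1 w2] :
    [/\ 0 <= (1 + e)^-1, 0 <= e / (1 + e) & (1 + e)^-1 + e / (1 + e) = 1].
  by split; rewrite ?divr_ge0 ?invr_ge0 ?ltW //; field; rewrite gt_eqF.
have Cm : C m by apply: convex_set_comb.
have Dm : D m by rewrite mE; apply: convex_set_comb.
have e1m (x y : V) :
    m = (1 + e)^-1 *: y + (e / (1 + e)) *: x -> y - m = - e *: (x - m).
  move=> mxy.
  have : (1 + e) *: m = y + e *: x.
    rewrite mxy scalerDr !scalerA mulrCA mulfV ?gt_eqF //.
    by rewrite scale1r mulr1.
  move=> mxyE; rewrite -[y](addrK (e *: x)) -mxyE scalerDl scale1r.
  by rewrite (addrC m) addrAC addrK scaleNr scalerBr opprB.
exists c', d'; split=> //; last by exists e.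
- exists (c' - m); last by exists m; rewrite // subrK.
  apply: (opposite _ e^-1); rewrite ?invr_gt0 //; first exact: Bsub.
  rewrite (e1m c c') // scalerA mulrNN mulVf ?gt_eqF // scale1r.
  exact: Bsub.
- exists (d' - m); last by exists m; rewrite // subrK.
  rewrite -opprB -scaleN1r -[_ *: _]addr0; apply: T_comb => //.
  apply: (opposite _ e^-1); rewrite ?invr_gt0 //; first exact: Bsub.
  rewrite -opprB (e1m d d') // scalerN scalerA mulrNN mulVf ?gt_eqF //.
  rewrite scale1r opprB.
  exact: Bsub.
Qed.

End joint_support_theory.

(** * Convex functions with extended real values *)

Section extended_convex.
Context {R : realType} {V : lmodType R}.
Implicit Types h k : V -> \bar R.

Lemma convex_efun_comb h (x y : V) (a b s t : R) : convex_efun h ->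
  (h x <= a%:E)%E -> (h y <= b%:E)%E -> 0 <= s -> 0 <= t -> s + t = 1 ->
  (h (s *: x + t *: y)%R <= (s * a + t * b)%R%:E)%E.
Proof.
move=> ch hx hy s0 t0 st.
exact: (@convex_set_comb R (V * R^o)%type _ (x, a) (y, b) s t ch).
Qed.

Lemma convex_efun_from_comb h :
  (forall (x y : V) (a b s t : R), (h x <= a%:E)%E -> (h y <= b%:E)%E ->
    0 < s -> 0 < t -> s + t = 1 ->
    (h (s *: x + t *: y)%R <= (s * a + t * b)%R%:E)%E) ->
  convex_efun h.
Proof.
move=> ch; apply: (@convex_set_from_comb R (V * R^o)%type) => -[x a] [y b] s t.
exact: ch.
Qed.

Lemma dom_bound h x : h x != -oo%E -> dom h x -> exists a, h x = a%:E.
Proof. by rewrite /dom /=; case: (h x) => // a; exists a. Qed.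

Lemma bound_dom h x a : (h x <= a%:E)%E -> dom h x.
Proof.
by rewrite /dom /= => hx; apply/eqP => h_oo; move: hx; rewrite h_oo leye_eq.
Qed.

Lemma le_on_dom h x c : (dom h x -> (c <= h x)%E) -> (c <= h x)%E.
Proof.
move=> ch; have [/ch//|/negP] := pselect (dom h x).
by rewrite negbK => /eqP ->; rewrite leey.
Qed.

Lemma convex_dom h : (forall x, h x != -oo%E) -> convex_efun h ->
  convex_set (dom h).
Proof.
move=> hN ch; apply: convex_set_from_comb => x y s t.
move=> /(dom_bound (hN x))[a hx] /(dom_bound (hN y))[b hy] s0 t0 st.
apply: (@bound_dom h _ (s * a + t * b)).
by apply: convex_efun_comb; rewrite ?hx ?hy ?lexx ?ltW.
Qed.

Lemma add_indicator_in h S x : S x -> (h x + indicator S x = h x)%E.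
Proof. by move=> Sx; rewrite /indicator mem_set // adde0. Qed.

Lemma add_indicator_notin h S x : h x != -oo%E -> ~ S x ->
  (h x + indicator S x = +oo)%E.
Proof. by move=> hx Sx; rewrite /indicator memNset // addeC addye. Qed.

Lemma add_indicator_neqNy h S x : h x != -oo%E -> (h x + indicator S x != -oo)%E.
Proof.
move=> hx; have [Sx|Sx] := pselect (S x); first by rewrite add_indicator_in.
by rewrite add_indicator_notin.
Qed.

Lemma add_indicator_ge h S x : (h x <= h x + indicator S x)%E.
Proof. by rewrite leeDl // /indicator; case: ifP. Qed.

Lemma dom_add_indicator h S x : h x != -oo%E ->
  dom (fun z => h z + indicator S z)%E x <-> dom h x /\ S x.
Proof.
move=> hx; rewrite /dom /=; have [Sx|Sx] := pselect (S x).
  by rewrite add_indicator_in //; split=> [|[]].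
by rewrite add_indicator_notin //; split=> [|[]].
Qed.

Lemma convex_add_indicator h S : (forall x, h x != -oo%E) ->
  convex_efun h -> convex_set S -> convex_efun (fun z => h z + indicator S z)%E.
Proof.
move=> hN ch cS; apply: convex_efun_from_comb => x y a b s t hx hy s0 t0 st.
have [_ Sx] := (dom_add_indicator S (hN x)).1 (bound_dom hx).
have [_ Sy] := (dom_add_indicator S (hN y)).1 (bound_dom hy).
have Sz : S (s *: x + t *: y) by apply: convex_set_comb; rewrite ?ltW.
rewrite add_indicator_in // in hx; rewrite add_indicator_in // in hy.
by rewrite add_indicator_in //; apply: convex_efun_comb => //; exact: ltW.
Qed.

End extended_convex.

Lemma is_minimizerP (R : realType) (V : Type) (h : V -> \bar R) x :
  is_minimizer h x <-> h x \is a fin_num /\ forall z, (h x <= h z)%E.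
Proof.
rewrite /is_minimizer; split=> [[hfin hx]|[hfin hx]].
  by split=> [|z]; rewrite hx //; apply: ereal_inf_lbound; exists z.
suff -> : ereal_inf (range h) = h x by [].
apply/eqP; rewrite eq_le; apply/andP; split.
  by apply: ereal_inf_lbound; exists x.
by apply: le_ereal_inf_tmp => _ [z _ <-].
Qed.

(** * Affine minorants and subgradients of the conjugate *)

Section biconjugation.
Context {R : realType} {n : nat}.
Implicit Types (h k : 'cV[R]_n -> \bar R) (a v w z : 'cV[R]_n).

(** Separating the points of [U] at height [r] from the epigraph of [h] yields
    either a nonvertical hyperplane, that is an affine minorant of [h] equal to
    [r] at [a], or a vertical one, which leaves [dom h] at a positive distance
    from [a] because [U] surrounds [a]. *)
Lemma graph_separation h (r : R) (U : set 'cV[R]_n) a :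
  (forall z, h z != -oo%E) -> dom h !=set0 -> convex_efun h ->
  nbhs a U -> (forall u, U u -> (r%:E < h u)%E) ->
  (exists w, forall z, ((r + dotp w (z - a))%R%:E <= h z)%E) \/
  (exists v (d : R), 0 < d /\ forall z, dom h z -> d <= dotp v (z - a)).
Proof.
move=> hN [z0 hz0] ch /nbhs_ballP[e /= e_gt0 aU] hU.
have ballP u : ball a e u <-> forall i, `|a i 0 - u i 0| < e.
  split=> [[_ au] i|au]; first exact: au.
  by split=> // i j; rewrite ord1; apply: au.
have balla : ball a e a by apply: ballxx.
pose K : set ('cV[R]_n * R^o) :=
  [set p | exists z u t, [/\ (h z <= t%:E)%E, ball a e u & p = (z - u, t - r)]].
have [a0 hz0E] := dom_bound (hN z0) hz0.
have [|||v [s [K_ge0 K_gt0]]] := @proper_separation_pair R n K.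
- apply: convex_set_from_comb => p q s t [z [u [b [hz au ->]]]].
  move=> [z' [u' [b' [hz' au' ->]]]] s0 t0 st.
  exists (s *: z + t *: z'), (s *: u + t *: u'), (s * b + t * b'); split.
  + by apply: convex_efun_comb => //; exact: ltW.
  + apply/ballP => i; move/ballP/(_ i) : au; move/ballP/(_ i) : au'.
    rewrite !mxE !ltr_norml => /andP[? ?] /andP[? ?].
    have -> : a i 0 - (s * u i 0 + t * u' i 0) =
      s * (a i 0 - u i 0) + t * (a i 0 - u' i 0).
      by rewrite -{1}[a i 0]mul1r -st; ring.
    have -> : e = s * e + t * e by rewrite -mulrDl st mul1r.
    by rewrite opprD -!mulrN !ltrD // ltr_pM2l.
  + congr pair => /=; first by rewrite !scalerBr opprD addrACA.
    by rewrite /GRing.scale /= -{3}[r]mul1r -st; ring.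
- by exists (z0 - a, a0 - r), z0, a, a0; split; rewrite // hz0E.
- move=> [z [u [t [hz au [/esym/eqP zu /esym/eqP tr]]]]].
  move: zu tr; rewrite !subr_eq0 => /eqP zu /eqP tr.
  by have := hU _ (aU _ au); rewrite -zu -tr ltNge hz.
have s_ge0 : 0 <= s.
  rewrite leNgt; apply/negP => s_lt0.
  (* if s < 0, raising the height by at least c makes the functional
     negative *)
  pose c := (dotp v (z0 - a) + s * (a0 - r) + 1) / (- s).
  have c0 : 0 <= Num.max 0 c by rewrite le_max lexx.
  have : K (z0 - a, a0 + Num.max 0 c - r).
    exists z0, a, (a0 + Num.max 0 c); split=> //.
    by rewrite hz0E lee_fin lerDl.
  move=> /K_ge0 /=.
  have : c <= Num.max 0 c by rewrite le_max lexx orbT.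
  by rewrite /c ler_pdivrMr ?oppr_gt0 //; lra.
have [s_gt0|s_le0] := ltP 0 s.
  left; exists (- s^-1 *: v) => z; apply: le_on_dom => hz.
  have [t hzE] := dom_bound (hN z) hz; rewrite hzE lee_fin.
  have : K (z - a, t - r) by exists z, a, t; split; rewrite // hzE.
  move=> /K_ge0 /= h0.
  have : - (t - r) <= dotp v (z - a) / s by rewrite ler_pdivlMr //; lra.
  by rewrite dotpZl mulNr (mulrC s^-1); lra.
have {s_ge0 s_le0}s0 : s = 0 by apply/le_anti/andP.
(* points of U in the direction of v push the bound above zero *)
right; subst s.
have v0 : v != 0.
  apply/eqP => v0; case: K_gt0 => p _.
  by rewrite v0 mul0r addr0 dotpC dotp0r ltxx.
pose c := \sum_i `|v i 0|.
have c0 : 0 <= c by apply: sumr_ge0.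
pose eta := e / (1 + c).
have c1 : 0 < 1 + c by rewrite ltr_pwDl.
have eta_gt0 : 0 < eta by rewrite divr_gt0.
exists v, (eta * dotp v v); split; first by rewrite mulr_gt0 ?dotp_self_gt0.
move=> z hz; have [t hzE] := dom_bound (hN z) hz.
have : K (z - (a + eta *: v), t - r).
  exists z, (a + eta *: v), t; split; rewrite ?hzE //; apply/ballP => i.
  rewrite !mxE opprD addrA subrr sub0r normrN normrM gtr0_norm //.
  rewrite /eta mulrAC ltr_pdivrMr // ltr_pM2l //.
  have : `|v i 0| <= c by rewrite /c (bigD1 i) //= lerDl sumr_ge0.
  lra.
by move=> /K_ge0 /=; rewrite mul0r addr0 !dotpBr dotpDr dotpZr; lra.
Qed.

(** Lower semicontinuity is asked of a minorant [k] of [h], so that [h] may be the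
    sum of [k] and the indicator of an arbitrary convex set. In the vertical case,
    a minorant obtained at a point of [dom h] is tilted by a large multiple of
    the functional that separates [a] from [dom h]. *)
Lemma affine_minorant h k a (r : R) :
  (forall z, h z != -oo%E) -> dom h !=set0 -> convex_efun h ->
  (forall z, k z != -oo%E) -> lower_semicontinuous k ->
  (forall z, (k z <= h z)%E) ->
  (r%:E < k a)%E ->
  exists w (c : R), (forall z, ((dotp w z + c)%R%:E <= h z)%E) /\ r <= dotp w a + c.
Proof.
move=> hN h0 ch kN klsc kh ra.
have sep b s : (s%:E < k b)%E ->
    (exists w, forall z, ((s + dotp w (z - b))%R%:E <= h z)%E) \/
    (exists v (d : R), 0 < d /\ forall z, dom h z -> d <= dotp v (z - b)).
  move=> /klsc[U bU Uk]; apply: (graph_separation hN h0 ch bU) => u /Uk.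
  by move=> /lt_le_trans; apply.
have [[w wh]|[v [d [d_gt0 vd]]]] := sep a r ra.
  exists w, (r - dotp w a); split=> [z|]; last lra.
  by have := wh z; rewrite dotpBr addrCA.
have [z0 hz0] := h0.
have [s sk] : exists s : R, (s%:E < k z0)%E.
  have := kN z0; case: (k z0) => [t _|_|//]; last by exists 0; rewrite ltry.
  by exists (t - 1); rewrite lte_fin ltrBlDr ltrDl.
have [[w wh]|[v' [d' [d'_gt0 vd']]]] := sep z0 s sk; last first.
  by have := vd' _ hz0; rewrite subrr dotp0r leNgt d'_gt0.
pose q := s + dotp w (a - z0).
pose l := `|r - q| / d.
have l_ge0 : 0 <= l by rewrite divr_ge0 // ltW.
have ld : l * d = `|r - q| by rewrite divfK // gt_eqF.
exists (w - l *: v), (s - dotp w z0 + l * (d + dotp v a)); split=> [z|].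
  apply: le_on_dom => hz.
  apply: le_trans (wh z); rewrite lee_fin.
  have := ler_wpM2l l_ge0 (vd z hz).
  by rewrite dotpDl dotpNl dotpZl !dotpBr; lra.
rewrite dotpDl dotpNl dotpZl.
have : r - q <= l * d by rewrite ld ler_norm.
rewrite /q dotpBr; lra.
Qed.

Lemma conjugate_subgradient h a v : (forall z, h z != -oo%E) ->
  subdiff h a v -> subdiff (conjugate h) v a.
Proof.
move=> hN [/set_mem ha va].
have [al haE] := dom_bound (hN a) ha.
have conjv : conjugate h v = (dotp v a - al)%:E.
  apply/eqP; rewrite eq_le; apply/andP; split.
    apply: ge_ereal_sup => _ [z _ <-].
    have := va z; rewrite haE; have := hN z.
    case: (h z) => [t _|_ _|//]; last by rewrite leNye.
    by rewrite -EFinD -EFinB !lee_fin dotpBr; lra.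
  by apply: ereal_sup_ubound; exists a; rewrite // haE.
split; first by rewrite inE /dom /= conjv.
move=> w; rewrite conjv; apply: ereal_sup_ubound; exists a => //.
by rewrite haE -EFinB -EFinD dotpBr ![dotp a _]dotpC; congr EFin; ring.
Qed.

(** If [h a] exceeded [<v, a> - conjugate h v], some affine minorant would exceed
    it too at [a], and its slope would contradict the subgradient inequality of
    the conjugate. So equality holds in the Fenchel-Young inequality. *)
Lemma subgradient_of_conjugate h k a v :
  (forall z, h z != -oo%E) -> dom h !=set0 -> convex_efun h ->
  (forall z, k z != -oo%E) -> lower_semicontinuous k ->
  (forall z, (k z <= h z)%E) ->
  k a = h a -> subdiff (conjugate h) v a -> subdiff h a v.
Proof.
move=> hN h0 ch kN klsc kh kha [/set_mem cv va].
have [z0 hz0] := h0; have [t0 hz0E] := dom_bound (hN z0) hz0.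
have [b cvE] : exists b, conjugate h v = b%:E.
  apply: dom_bound => //; rewrite -ltNye.
  apply: (@lt_le_trans _ _ (dotp v z0 - t0)%:E).
    exact: ltNyr.
  by apply: ereal_sup_ubound; exists z0; rewrite // hz0E.
have ha : (h a <= (dotp v a - b)%R%:E)%E.
  rewrite leNgt; apply/negP => ah.
  have [r r1 r2] : exists2 r : R, dotp v a - b < r & (r%:E < k a)%E.
    move: ah; rewrite kha; case: (h a) => [t|_|//]; last first.
      by exists (dotp v a - b + 1); rewrite ?ltry // ltrDl.
    rewrite lte_fin => tb; exists ((dotp v a - b + t) / 2); rewrite ?lte_fin; lra.
  have [w [c [wh rw]]] := affine_minorant hN h0 ch kN klsc kh r2.
  have : (conjugate h w <= (- c)%R%:E)%E.
    apply: ge_ereal_sup => _ [z _ <-].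
    have := wh z; have := hN z; case: (h z) => [t _|_ _|//]; last by rewrite leNye.
    by rewrite -EFinB !lee_fin; lra.
  move=> /(le_trans (va w)); rewrite cvE -EFinD lee_fin dotpBr ![dotp a _]dotpC.
  lra.
have [al haE] := dom_bound (hN a) (bound_dom ha).
split; first by rewrite inE; apply: bound_dom ha.
move=> z; rewrite haE; apply: le_on_dom => hz.
have [t hzE] := dom_bound (hN z) hz.
have : ((dotp v z - t)%R%:E <= conjugate h v)%E.
  by apply: ereal_sup_ubound; exists z; rewrite // hzE.
move: ha; rewrite haE hzE cvE -EFinD !lee_fin dotpBr; lra.
Qed.

End biconjugation.

(** * The sum rule and the optimality condition *)

(** A dual solution is the normalized slope [- v / s] of a hyperplane that
    separates the origin from the points above the value function
    [u |-> inf (f z + g w | A z - w = u)], shifted to vanish at the origin. The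
    symmetry assumption on [A z - w] forces [s] to be nonzero. *)
Lemma subgradient_sum_rule (R : realType) (n m : nat)
    (f : 'cV[R]_n -> \bar R) (g : 'cV[R]_m -> \bar R) (A : 'M[R]_(m, n)) x :
  (forall z, f z != -oo%E) -> convex_efun f ->
  (forall w, g w != -oo%E) -> convex_efun g ->
  dom f x -> dom g (A *m x) ->
  (forall z w, dom f z -> dom g w -> exists z' w', [/\ dom f z', dom g w' &
     exists2 e : R, 0 < e & A *m z' - w' = - e *: (A *m z - w)]) ->
  (forall z, (f x + g (A *m x) <= f z + g (A *m z))%E) ->
  exists y, subdiff g (A *m x) (- y) /\ subdiff f x (A^T *m y).
Proof.
move=> fN cf gN cg fx gAx opp xmin.
have [al fxE] := dom_bound (fN x) fx; have [be gxE] := dom_bound (gN _) gAx.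
pose K : set ('cV[R]_m * R^o) := [set p | exists z w a b,
  [/\ (f z <= a%:E)%E, (g w <= b%:E)%E, p.1 = A *m z - w &
      a + b - (al + be) < p.2]].
have [|||v [s [K_ge0 [p0 Kp0 p0_gt0]]]] := @proper_separation_pair R m K.
- apply: convex_set_from_comb => p p' s t [z [w [a [b [fz gw pE ab]]]]].
  move=> [z' [w' [a' [b' [fz' gw' pE' ab']]]]] s0 t0 st.
  exists (s *: z + t *: z'), (s *: w + t *: w'), (s * a + t * a'),
    (s * b + t * b'); split.
  + by apply: convex_efun_comb => //; exact: ltW.
  + by apply: convex_efun_comb => //; exact: ltW.
  + by rewrite /= pE pE' mulmxDr -!scalemxAr !scalerBr opprD addrACA.
  + have -> : s * a + t * a' + (s * b + t * b') - (al + be) =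
        s * (a + b - (al + be)) + t * (a' + b' - (al + be)).
      by rewrite -{1}[al + be]mul1r -st; ring.
    by rewrite /= /GRing.scale /= ltrD // ltr_pM2l.
- exists (0, 1), x, (A *m x), al, be; split; rewrite ?fxE ?gxE //= ?subrr //.
- move=> [z [w [a [b [fz gw /= /esym/eqP]]]]]; rewrite subr_eq0 => /eqP Azw ab.
  have := xmin z; rewrite fxE gxE Azw leNgt => /negP; apply.
  by apply: (le_lt_trans (leeD fz gw)); rewrite -!EFinD lte_fin; lra.
have K_up z w (a b : R) c : (f z <= a%:E)%E -> (g w <= b%:E)%E ->
    a + b - (al + be) < c -> 0 <= dotp v (A *m z - w) + s * c.
  by move=> fz gw abc; apply: (K_ge0 (A *m z - w, c)); exists z, w, a, b.
have s_ge0 : 0 <= s.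
  rewrite leNgt; apply/negP => s_lt0.
  have s'_gt0 : 0 < - s by rewrite oppr_gt0.
  (* at height - 1 / s above the origin the functional equals -1 *)
  have := K_up x (A *m x) al be (- s)^-1.
  rewrite fxE gxE !subrr dotp0r invr_gt0 s'_gt0 add0r => /(_ (lexx _) (lexx _) isT).
  by rewrite invrN mulrN mulfV ?lt_eqF // oppr_ge0 ler10.
have s_gt0 : 0 < s.
  rewrite lt_neqAle s_ge0 andbT eq_sym; apply/eqP => s0.
  case: Kp0 => z [w [a [b [fz gw pE _]]]].
  have [z' [w' [fz' gw' [e e_gt0 zwE]]]] := opp _ _ (bound_dom fz) (bound_dom gw).
  have [a' fzE'] := dom_bound (fN z') fz'; have [b' gwE'] := dom_bound (gN w') gw'.
  have := K_up z' w' a' b' (a' + b' - (al + be) + 1).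
  rewrite fzE' gwE' ltrDl ltr01 s0 mul0r addr0 => /(_ (lexx _) (lexx _) isT).
  move: p0_gt0; rewrite s0 mul0r addr0 pE zwE dotpZr; nra.
have K_lim z w (a b : R) : (f z <= a%:E)%E -> (g w <= b%:E)%E ->
    - (dotp v (A *m z - w) / s) <= a + b - (al + be).
  move=> fz gw; apply/ler_addgt0Pr => e e_gt0.
  have := K_up z w a b (a + b - (al + be) + e) fz gw.
  rewrite ltrDl => /(_ e_gt0) h.
  by rewrite -mulNr ler_pdivrMr // mulrC; lra.
exists (- s^-1 *: v); split; split; rewrite ?inE //.
  move=> w; apply: le_on_dom => gw.
  have [b gwE] := dom_bound (gN w) gw.
  have := K_lim x w al b; rewrite fxE gxE gwE -EFinD !lee_fin.
  move=> /(_ (lexx _) (lexx _)).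
  by rewrite scaleNr opprK dotpZl !dotpBr [_^-1 * _]mulrC !mulrBl; lra.
move=> z; apply: le_on_dom => fz.
have [a fzE] := dom_bound (fN z) fz.
have := K_lim z (A *m x) a be; rewrite fxE gxE fzE -EFinD !lee_fin.
move=> /(_ (lexx _) (lexx _)).
by rewrite dotp_trmx scaleNr dotpNl dotpZl mulmxBr [_^-1 * _]mulrC; lra.
Qed.

Theorem corollary5p6 (R : realType) (n m : nat)
    (f : 'cV[R]_n -> \bar R) (g : 'cV[R]_m -> \bar R) (A : 'M[R]_(m, n))
    (f_lsc : lower_semicontinuous f) (f_proper : proper_efun f)
    (f_convex : convex_efun f)
    (g_lsc : lower_semicontinuous g) (g_proper : proper_efun g)
    (g_convex : convex_efun g)
    (x : 'cV[R]_n) :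
  let Ta := affine_joint_support (mulmx A @` dom f) (dom g) in
  is_minimizer (fun z => (f z + g (A *m z))%E) x <->
  exists y : 'cV[R]_m,
    subdiff (conjugate (fun z => (g z + indicator Ta z)%E)) (- y) (A *m x) /\
    subdiff (fun z => (f z + indicator (mulmx A @^-1` Ta) z)%E) x (A^T *m y).
Proof.
move=> Ta; have [fN _] := f_proper; have [gN _] := g_proper.
pose f' z := (f z + indicator (mulmx A @^-1` Ta) z)%E.
pose g' z := (g z + indicator Ta z)%E.
have f'N z : f' z != -oo%E by apply: add_indicator_neqNy.
have g'N z : g' z != -oo%E by apply: add_indicator_neqNy.
have cC : convex_set (mulmx A @` dom f).
  apply: convex_set_from_comb => _ _ s t [z fz <-] [z' fz' <-] s0 t0 st.
  exists (s *: z + t *: z'); last by rewrite mulmxDr -!scalemxAr.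
  by apply: convex_set_comb; rewrite ?ltW //; exact: convex_dom.
have cD : convex_set (dom g) by exact: convex_dom.
have cTa : convex_set Ta by exact: convex_affine_joint_support.
have cf' : convex_efun f'.
  apply: convex_add_indicator => //.
  apply: convex_set_from_comb => z z' s t Tz Tz' s0 t0 st.
  by rewrite /= mulmxDr -!scalemxAr; apply: convex_set_comb; rewrite ?ltW.
have cg' : convex_efun g' by exact: convex_add_indicator.
have domf' z : dom f' z <-> dom f z /\ Ta (A *m z) by exact: dom_add_indicator.
have domg' w : dom g' w <-> dom g w /\ Ta w by exact: dom_add_indicator.
have TaI z : dom f z -> dom g (A *m z) -> Ta (A *m z).
  by move=> fz gz; apply: affine_joint_support_meet => //; exists z.
have sumE z : Ta (A *m z) -> (f' z + g' (A *m z) = f z + g (A *m z))%E.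
  by move=> Tz; rewrite /f' /g' !add_indicator_in.
have sumP z : (dom f z /\ dom g (A *m z)) \/ (f z + g (A *m z) = +oo)%E.
  have [fz|/negP] := pselect (dom f z); last first.
    by rewrite negbK => /eqP ->; right; rewrite addye.
  have [gz|/negP] := pselect (dom g (A *m z)); first by left.
  by rewrite negbK => /eqP ->; right; rewrite addey.
split=> [/is_minimizerP[h_fin hmin]|[y [gy fy]]].
  have [[fx gx]|h_oo] := sumP x; last by rewrite h_oo in h_fin.
  have Tx := TaI _ fx gx.
  have [||z w|z|y [gy fy]] := @subgradient_sum_rule R n m f' g' A x f'N cf' g'N cg'.
  - exact/domf'.
  - exact/domg'.
  - move=> /domf'[fz Tz] /domg'[gw Tw].
    have Cz : (mulmx A @` dom f) (A *m z) by exists z.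
    have [_ [w' [[z' fz' <-] gw' Tz' Tw' ezw]]] :=
      affine_joint_support_opposite cC cD Cz gw Tz Tw.
    by exists z', w'; split=> //; [exact/domf'|exact/domg'].
  - rewrite sumE //; apply: le_trans (hmin z) _.
    by apply: leeD; exact: add_indicator_ge.
  - by exists y; split=> //; exact: conjugate_subgradient.
have [/set_mem/domf'[fx Tx] _] := fy.
have gx' : subdiff g' (A *m x) (- y).
  have [u _ [p [[q fq qp] gp] _]] := Tx.
  apply: (@subgradient_of_conjugate R m g' g) => //.
  - exists p; apply/domg'; split=> //.
    by apply: affine_joint_support_meet => //; exists q.
  - by move=> w; exact: add_indicator_ge.
  - by rewrite /g' add_indicator_in.
have [/set_mem/domg'[gx _] _] := gx'.
have [a fxE] := dom_bound (fN x) fx; have [b gxE] := dom_bound (gN _) gx.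
apply/is_minimizerP; split=> [|z]; first by rewrite fxE gxE.
have [[fz gz]|->] := sumP z; last by rewrite leey.
have [c fzE] := dom_bound (fN z) fz; have [d gzE] := dom_bound (gN _) gz.
have [_ /(_ (A *m z))] := gx'; have [_ /(_ z)] := fy.
rewrite /f' /g' !add_indicator_in //; [|exact: TaI|exact: TaI].
rewrite fxE fzE gxE gzE -!EFinD !lee_fin dotp_trmx dotpNl mulmxBr; lra.
Qed.
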